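(* Let $P\subset\mathbb R^n$ be a bounded open convex set and $\mu$ Lebesgue measure. Then there exists a convex function $\phi\in L^1(P)$ with $\int_P\phi\,d\mu=0$ and $\inf_P\phi=-1$ (in particular $\phi\not\equiv 0$) such that $$-\frac{2}{n+1}\left(\frac{n}{n+1}\right)^n\inf_P\phi=\frac{1}{\mu(P)}\int_P|\phi|\,d\mu .$$
   Context: For every convex $\phi\in L^1(P)$ with $\int_P\phi\,d\mu=0$ one has $-\frac{2}{n+1}\left(\frac{n}{n+1}\right)^n\inf_P\phi\le\frac{1}{\mu(P)}\int_P|\phi|\,d\mu\le -2\inf_P\phi$; the claim asserts that the first of these inequalities is attained by a nonzero function. *)

(* Defs.v *)
From HB Require Import structures.
From mathcomp Require Import all_boot all_order all_algebra.
From mathcomp Require Import all_classical all_reals all_analysis.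
Set Implicit Arguments. Unset Strict Implicit. Unset Printing Implicit Defensive.
Import Order.TTheory GRing.Theory Num.Theory numFieldNormedType.Exports.
Local Open Scope classical_set_scope.
Local Open Scope ring_scope.

(** Product of two sigma-finite measures, packaged again as a sigma-finite
    measure (the library's generic sigma-finite instance on [product_measure1]
    is shadowed by a more specific one, so we re-declare it on an alias). *)
Section prodm.
Local Open Scope ereal_scope.
Context d1 d2 (T1 : measurableType d1) (T2 : measurableType d2) (R : realType).
Variable m1 : {sigma_finite_measure set T1 -> \bar R}.
Variable m2 : {sigma_finite_measure set T2 -> \bar R}.

Definition prodm : set (T1 * T2) -> \bar R := m1 \x m2.
HB.instance Definition _ := Measure.on prodm.

Lemma prodm_sigma_finite : sigma_finite setT prodm.
Proof.
have /sigma_finiteP[F [TF ndF Foo]] := sigma_finiteT m1.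
have /sigma_finiteP[G [TG ndG Goo]] := sigma_finiteT m2.
exists (fun n => F n `*` G n).
 rewrite -setXTT TF TG predeqE => -[x y]; split.
    move=> [/= [n _ Fnx] [k _ Gky]]; exists (maxn n k) => //; split.
    - by move: x Fnx; exact/subsetPset/ndF/leq_maxl.
    - by move: y Gky; exact/subsetPset/ndG/leq_maxr.
  by move=> [n _ []/= ? ?]; split; exists n.
move=> k; have [? ?] := Foo k; have [? ?] := Goo k.
split; first exact: measurableX.
by rewrite /prodm product_measure1E// lte_mul_pinfty// ge0_fin_numE.
Qed.

HB.instance Definition _ := Measure_isSigmaFinite.Build _ _ _ prodm
  prodm_sigma_finite.
End prodm.

Section lebn.
Variable R : realType.

Fixpoint dispn (n : nat) : measure_display :=
  match n with
  | 0 => default_measure_display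
  | n.+1 => measure_prod_display (@sigma_display R (R.-ocitv.-measurable), dispn n)
  end.

Fixpoint Rprod (n : nat) : measurableType (dispn n) :=
  match n with 0 => unit | n.+1 => (measurableTypeR R * Rprod n)%type end.

Fixpoint lebn (n : nat) : {sigma_finite_measure set (Rprod n) -> \bar R} :=
  match n with
  | 0 => (@dirac _ (Rprod 0) tt R : {sigma_finite_measure set (Rprod 0) -> \bar R})
  | n.+1 => SigmaFiniteMeasure.clone _ _ R (prodm (@lebesgue_measure R) (lebn n)) _
  end.

Fixpoint prod_to_row (n : nat) : Rprod n -> 'rV[R]_n :=
  match n return Rprod n -> 'rV[R]_n with
  | 0 => fun _ => 0
  | n.+1 => fun x : (measurableTypeR R * Rprod n)%type => row_mx (const_mx x.1 : 'rV[R]_1) (@prod_to_row n x.2)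
  end.
End lebn.

Section rV_measure.
Variable R : realType.
Local Open Scope ereal_scope.

Definition leb_rV (n : nat) (A : set 'rV[R]_n) : \bar R :=
  lebn R n (@prod_to_row R n @^-1` A).

Definition int_rV (n : nat) (A : set 'rV[R]_n) (f : 'rV[R]_n -> R) : \bar R :=
  \int[lebn R n]_(x in @prod_to_row R n @^-1` A) (f (prod_to_row x))%:E.

Definition integrable_rV (n : nat) (A : set 'rV[R]_n) (f : 'rV[R]_n -> R) : Prop :=
  (lebn R n).-integrable (@prod_to_row R n @^-1` A)
    (fun x => (f (prod_to_row x))%:E).
End rV_measure.

(* Main.v *)
(** The extremal function is [(n+1)/n * g - 1], where [g] is the Minkowski gauge
    of [P] about any point [c] of [P]: its infimum -1 is attained at [c]. All
    sublevel sets [g < t] are homothetic copies of [P], so the truncated cones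
    [C_t := max 0 (t - g)] satisfy [int C_t = t^(n+1) * K] with [K := int C_1].
    Comparing [C_1] with [C_s] for [s < 1] and letting [s] tend to 1 gives
    [(n+1) * K = mu P] without polar coordinates or a layer-cake formula. On [P],
    both the function and its absolute value are affine combinations of 1,
    [C_1] and [C_(n/(n+1))]. *)
Require Import Defs.
From HB Require Import structures.
From mathcomp Require Import all_boot all_order all_algebra.
From mathcomp Require Import all_classical all_reals all_analysis.
From mathcomp Require Import measurable_realfun ring lra.
Import Order.TTheory GRing.Theory Num.Theory numFieldNormedType.Exports.
Local Open Scope classical_set_scope.
Local Open Scope ring_scope.

(** Uniqueness theorems compare bundled measures; this bundles a rescaled push-forward so that they
    apply to it. *)
Lemma scaled_pushforward_measure {d1 d2} {T1 : measurableType d1}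
    {T2 : measurableType d2} {R : realType} (mu : {measure set T1 -> \bar R})
    {f : T1 -> T2} {k : R} : measurable_fun setT f -> 0 <= k ->
  exists m : {measure set T2 -> \bar R},
    forall A, m A = (k%:E * mu (f @^-1` A))%E.
Proof.
move=> mf k0.
unshelve eexists (mscale (NngNum k0)
  (pushforward mu f : {measure set T2 -> \bar R}) : {measure set T2 -> \bar R}).
  exact: mf.
by move=> A.
Qed.

(** * Homotheties with translation, and how they scale Lebesgue measure *)

Section affine_maps.
Context {R : realType}.

(** Recursion along [Rprod] makes this a product map, so measurability and scaling follow by
    induction on the dimension. *)
Fixpoint affmap (s : R) (n : nat) : Rprod R n -> Rprod R n -> Rprod R n :=
  match n with
  | 0 => fun _ x => x
  | n.+1 => fun b x : (measurableTypeR R * Rprod R n)%type =>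
      (s * x.1 + b.1, @affmap s n b.2 x.2)
  end.

Lemma prod_to_row_affmap (s : R) (n : nat) (b x : Rprod R n) :
  prod_to_row (affmap s n b x) = s *: prod_to_row x + prod_to_row b.
Proof.
elim: n b x => [|n IH] b x; first by rewrite [LHS]thinmx0 [RHS]thinmx0.
rewrite [LHS]/= IH -[RHS]/(s *: row_mx (const_mx x.1 : 'rV_1) (prod_to_row x.2)
  + row_mx (const_mx b.1) (prod_to_row b.2)) scale_row_mx add_row_mx.
by congr (row_mx _ _ : 'rV_(1 + n)); apply/rowP => i; rewrite !mxE.
Qed.

Lemma prod_to_row_surj (n : nat) (v : 'rV[R]_n) :
  exists b : Rprod R n, prod_to_row b = v.
Proof.
elim: n v => [|n IH] v; first by exists tt; rewrite [LHS]thinmx0 [RHS]thinmx0.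
have [b bE] := IH (rsubmx (v : 'rV_(1 + n))).
exists ((v 0 0, b) : Rprod R n.+1) => /=.
rewrite bE -[RHS](@hsubmxK _ 1 1 n v); congr (row_mx _ _ : 'rV_(1 + n)).
by apply/rowP => i; rewrite !mxE ord1; congr (v _ _); exact/val_inj.
Qed.

Lemma measurable_affmap (s : R) (n : nat) (b : Rprod R n) :
  measurable_fun setT (affmap s n b).
Proof.
elim: n b => [|n IH] b; first exact: measurable_id.
apply: measurable_fun_pair.
  apply: measurable_funD; last exact: measurable_cst.
  by apply: measurable_funM; [exact: measurable_cst|exact: measurable_fst].
by apply: measurableT_comp; [exact: IH|exact: measurable_snd].
Qed.

Lemma prod_to_row_ord0 (n : nat) (x : Rprod R n.+1) :
  prod_to_row x 0 ord0 = x.1.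
Proof.
rewrite -[LHS]/((row_mx (const_mx x.1) (prod_to_row x.2) : 'rV_(1 + n)) 0 ord0).
have -> : ord0 = lshift n 0 :> 'I_(1 + n) by exact/val_inj.
by rewrite row_mxEl mxE.
Qed.

Lemma prod_to_row_lift (n : nat) (x : Rprod R n.+1) (j : 'I_n) :
  prod_to_row x 0 (lift ord0 j) = prod_to_row x.2 0 j.
Proof.
rewrite -[LHS]/((row_mx (const_mx x.1 : 'rV_1) (prod_to_row x.2) : 'rV_(1 + n))
  0 (lift ord0 j)).
have -> : lift ord0 j = rshift 1 j :> 'I_(1 + n) by exact/val_inj.
by rewrite row_mxEr.
Qed.

Let mf1 (s b : R) : measurable_fun setT
  (fun x : measurableTypeR R => s * x + b : measurableTypeR R).
Proof.
apply: measurable_funD; last exact: measurable_cst.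
by apply: measurable_funM; [exact: measurable_cst|exact: measurable_id].
Qed.

(** The push-forward multiplied by [s] agrees with Lebesgue measure on half-open intervals, hence
    everywhere by uniqueness. *)
Lemma lebesgue_measure_affine (s b : R) (A : set (measurableTypeR R)) :
  0 < s -> measurable A ->
  lebesgue_measure ((fun x => s * x + b) @^-1` A) =
  ((s^-1)%:E * lebesgue_measure A)%E.
Proof.
move=> s0 mA.
have [p pE] := scaled_pushforward_measure lebesgue_measure (mf1 s b) (ltW s0).
have -> : lebesgue_measure A = p A; last first.
  by rewrite pE muleA -EFinM mulVf ?gt_eqF// mul1e.
apply: lebesgue_measure_unique => //= _ [[x y]] _ <-.
  rewrite pE.
  have -> : (fun z => s * z + b) @^-1` `]x, y]%classic = `](x - b) / s, (y - b) / s]%classic.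
    apply/seteqP; split=> z /=; rewrite !in_itv /= ltr_pdivrMr// ler_pdivlMr//;
      by rewrite ltrBlDr lerBrDr mulrC.
  rewrite lebesgue_measure_itv/= (lebesgue_measure_itv `](x - b) / s, (y - b) / s]).
  rewrite /= !lte_fin ltr_pM2r ?invr_gt0// ltrD2r.
  case: ifP => _; last by rewrite mule0.
  by rewrite -!EFinB -EFinM; congr EFin; field; rewrite gt_eqF.
Qed.

(** The preimage of a rectangle is a rectangle whose sides scale by [s^-1] and [s ^- n]; uniqueness
    of the product measure extends this to all measurable sets. *)
Lemma lebn_affmap (s : R) (n : nat) (b : Rprod R n) (A : set (Rprod R n)) :
  0 < s -> measurable A ->
  lebn R n (affmap s n b @^-1` A) = ((s ^- n)%:E * lebn R n A)%E.
Proof.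
move=> s0; elim: n b A => [|n IH] b A mA.
  by rewrite expr0 invr1 mul1e.
have sn0 : 0 <= s ^+ n.+1 by rewrite exprn_ge0// ltW.
have [p pE] := scaled_pushforward_measure (lebn R n.+1)
  (measurable_affmap s n.+1 b) sn0.
have -> : lebn R n.+1 A = p A.
  apply: (@product_measure_unique _ _ _ _ R (@lebesgue_measure R) (lebn R n)) => //.
  move=> B C mB mC; rewrite pE.
  have -> : affmap s n.+1 b @^-1` (B `*` C) =
    ((fun x => s * x + b.1) @^-1` B) `*` (affmap s n b.2 @^-1` C).
    by [].
  rewrite [X in (_ * X)%E]product_measure1E; last 2 first.
  - by rewrite -[X in measurable X]setTI; exact: mf1.
  - by rewrite -[X in measurable X]setTI; exact: measurable_affmap.
  rewrite [X in (_ * (X * _))%E](lebesgue_measure_affine _ b.1 _ s0 mB) IH//.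
  have cancel (u v w : R) (y z : \bar R) : u * (v * w) = 1 ->
      (u%:E * ((v%:E * y) * (w%:E * z)) = y * z)%E.
    by move=> uvw; rewrite muleACA (muleA u%:E (_ * _)%E) -!EFinM uvw mul1e.
  apply: cancel.
  by rewrite exprS -invfM mulfV// mulf_neq0 ?expf_neq0 ?gt_eqF.
rewrite pE muleA -EFinM mulVf ?mul1e//.
by rewrite expf_neq0// gt_eqF.
Qed.

Lemma ge0_integral_affmap (s : R) (n : nat) (b : Rprod R n)
    (f : Rprod R n -> \bar R) :
  0 < s -> measurable_fun setT f -> (forall x, 0 <= f x)%E ->
  (\int[lebn R n]_x f (affmap s n b x) = (s ^- n)%:E * \int[lebn R n]_x f x)%E.
Proof.
move=> s0 mf f0.
have sn0 : 0 <= s ^- n by rewrite invr_ge0 exprn_ge0// ltW.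
rewrite -(ge0_integral_mscale (lebn R n) measurableT (NngNum sn0))//.
transitivity (\int[pushforward (lebn R n) (affmap s n b)]_x f x)%E.
  by rewrite (ge0_integral_pushforward (measurable_affmap s n b)).
apply: eq_measure_integral; first exact: measurable_affmap.
by move=> h A mA _; exact: lebn_affmap.
Qed.

End affine_maps.

(** * Measure of balls and measurability of open sets of row vectors *)

Section open_sets.
Context {R : realType}.

(** Balls of row vectors are taken in the sup norm, so they are cubes and split off one
    coordinate. *)
Lemma preimage_ballS (n : nat) (b : Rprod R n.+1) (e : R) : 0 < e ->
  @prod_to_row R n.+1 @^-1` ball (prod_to_row b) e =
  ball (b.1 : R) e `*` (@prod_to_row R n @^-1` ball (prod_to_row b.2) e).
Proof.
move=> e0.
apply/seteqP; split=> x [].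
- move=> _ h; split.
    by have := h 0 ord0; rewrite !prod_to_row_ord0.
  by split=> // i j; have := h 0 (lift ord0 j); rewrite !prod_to_row_lift ord1.
- move=> h1 [_ h2]; split=> // i j; rewrite ord1.
  case: (unliftP ord0 j) => [k|] ->; last by rewrite !prod_to_row_ord0.
  by rewrite !prod_to_row_lift; exact: h2.
Qed.

Lemma measurable_preimage_ball (n : nat) (b : Rprod R n) (e : R) : 0 < e ->
  measurable (@prod_to_row R n @^-1` ball (prod_to_row b) e).
Proof.
move=> e0; elim: n b => [|n IH] b; first exact: I.
rewrite preimage_ballS//; apply: measurableX; last exact: IH.
exact: measurable_ball.
Qed.

Lemma lebn_preimage_ball (n : nat) (b : Rprod R n) (e : R) : 0 < e ->
  lebn R n (@prod_to_row R n @^-1` ball (prod_to_row b) e) = ((e *+ 2) ^+ n)%:E.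
Proof.
move=> e0; elim: n b => [|n IH] b.
  rewrite expr0 /= /dirac indicE mem_set//=.
  by split=> // i [].
rewrite preimage_ballS//.
rewrite [LHS]product_measure1E; last 2 first.
- exact: measurable_ball.
- exact: measurable_preimage_ball.
rewrite exprS EFinM; congr (_ * _)%E; last exact: IH.
by rewrite /= lebesgue_measure_ball// ltW.
Qed.

(** An open set is the countable union of the balls with rational centre and radius that it
    contains. *)
Lemma measurable_preimage_open {n : nat} {P : set 'rV[R]_n} :
  open P -> measurable (@prod_to_row R n @^-1` P).
Proof.
move=> oP.
pose c (k : 'rV[rat]_n * rat) : 'rV[R]_n := map_mx ratr k.1.
pose F k := if `[< 0 < (ratr k.2 : R) /\ ball (c k) (ratr k.2) `<=` P >]
  then @prod_to_row R n @^-1` ball (c k) (ratr k.2) else set0.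
rewrite (_ : _ @^-1` P = \bigcup_k F k).
  apply: countable_bigcupT_measurable; first exact: countableP.
  move=> k; rewrite /F; case: ifPn => [/asboolP[k0 _]|_]; last exact: measurable0.
  have [b <-] := prod_to_row_surj n (c k).
  exact: measurable_preimage_ball.
apply/seteqP; split=> x /=; last first.
  move=> [k _]; rewrite /F; case: ifPn => [/asboolP[_ kP] /kP//|_ //].
set v := prod_to_row x => Pv.
move: oP; rewrite openE => /(_ v Pv) /nbhs_ballP[r /= r0 rP].
(* With a centre within [r / 4] of [v], a radius above [r / 4] captures [v], and a radius below
   [r / 2] keeps the ball inside the [r]-ball about [v]. *)
have [q] : exists q : rat, ratr q \in `]r / 4, r / 2[.
  by apply: rat_in_itvoo; lra.
rewrite in_itv/= => /andP[q1 q2].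
have /choice[w wP] (i : 'I_n) : exists p : rat, ratr p \in `](v 0 i - r / 4), (v 0 i + r / 4)[.
  by apply: rat_in_itvoo; lra.
have xc : ball (c (\row_i w i, q)) (ratr q) v.
  split; first by apply: lt_trans q1; lra.
  move=> i j; rewrite ord1 /c !mxE /ball /=.
  have := wP j; rewrite in_itv/= => /andP[? ?].
  by rewrite ltr_norml; apply/andP; split; lra.
exists (\row_i w i, q) => //; rewrite /F; case: asboolP => [_|]; first exact: xc.
case; split=> /=; first by apply: lt_trans q1; lra.
move=> u cu; apply: rP.
have : ball v (ratr q + ratr q) u by exact: ball_triangle (ball_sym xc) cu.
by apply: le_ball; lra.
Qed.

End open_sets.

(** * The Minkowski gauge of an open convex set *)

Section gauge.
Context {R : realType} {E : normedModType R}.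

Definition gauge (P : set E) (c x : E) : R :=
  inf [set t | 0 < t /\ P (c + t^-1 *: (x - c))].

Lemma convex_set_conv {P : set (convex_lmodType E)} {x y : E} {t : R} :
  convex_set P -> 0 <= t -> t <= 1 -> P x -> P y -> P (t *: x + (1 - t) *: y).
Proof.
move=> cP t0 t1 /mem_set Px /mem_set Py.
by have := cP x y (Itv01 t0 t1) Px Py; rewrite inE.
Qed.

Lemma convex_set_homothety {P : set (convex_lmodType E)} {c x : E} {t : R} :
  convex_set P -> 0 <= t -> t <= 1 -> P c -> P x -> P (c + t *: (x - c)).
Proof.
move=> cP t0 t1 Pc Px; have := convex_set_conv cP t0 t1 Px Pc.
by congr P; rewrite scalerBr scalerBl scale1r addrC -addrA [- _ + _]addrC.
Qed.

Lemma open_shift {P : set E} {x : E} (v : E) : open P -> P x ->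
  exists2 d : R, 0 < d & P (x + d *: v).
Proof.
rewrite openE => + Px => /(_ x Px) /nbhs_ballP[r /= r0 rP].
have v1 : 0 < `|v| + 1 by rewrite ltr_wpDl.
(* Adding 1 keeps the denominator positive when [v] is zero. *)
exists (r / 2 / (`|v| + 1)); first by rewrite !divr_gt0.
apply: rP; rewrite -ball_normE /ball_ /= opprD addNKr normrN normrZ.
rewrite gtr0_norm ?divr_gt0// mulrAC ltr_pdivrMr//.
apply: (@le_lt_trans _ _ (r / 2 * (`|v| + 1))).
  by rewrite ler_pM2l ?divr_gt0// lerDl.
by rewrite ltr_pM2r// ltr_pdivrMr// ltr_pMr// ltr1n.
Qed.

Context {P : set E} {c : E}.
Hypotheses (oP : open P) (cP : convex_set (P : set (convex_lmodType E))).
Hypothesis Pc : P c.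

(** Ensures that [inf] in [gauge] is a genuine infimum: since [P] is open, it contains a short step
    from [c] towards [x]. *)
Let has_inf_gauge x : has_inf [set t | 0 < t /\ P (c + t^-1 *: (x - c))].
Proof.
split; last by exists 0 => t [/ltW].
have [d d0 Pd] := open_shift (x - c) oP Pc.
by exists d^-1; rewrite /= invr_gt0 invrK.
Qed.

Lemma gauge_ge0 x : 0 <= gauge P c x.
Proof.
by apply: lb_le_inf; [exact: (has_inf_gauge x).1|move=> t [/ltW]].
Qed.

(** Forward, an admissible [u < t] exists and [P] is star-shaped about [c]. Backward, openness
    allows a slight push outwards, making [t / (1 + d) < t] admissible. *)
Lemma gauge_lt x t : 0 < t -> gauge P c x < t <-> P (c + t^-1 *: (x - c)).
Proof.
move=> t0; split.
  move=> /inf_lt => /(_ (has_inf_gauge x).1) [u [u0 Pu] ut].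
  have ut0 : 0 <= u / t by rewrite divr_ge0// ltW.
  have ut1 : u / t <= 1 by rewrite ler_pdivrMr// mul1r ltW.
  have := convex_set_homothety cP ut0 ut1 Pc Pu.
  by rewrite [X in X - c]addrC addrK scalerA mulrAC mulfV ?gt_eqF// mul1r.
move=> Pt; have [d d0 Pd] := open_shift (t^-1 *: (x - c)) oP Pt.
apply: (@le_lt_trans _ _ (t / (1 + d))).
  apply: ge_inf; first exact: (has_inf_gauge x).2.
  split; first by rewrite divr_gt0// addr_gt0.
  move: Pd; congr P.
  by rewrite -addrA invf_div mulrDl mul1r scalerDl scalerA.
by rewrite ltr_pdivrMr ?addr_gt0// ltr_pMr// ltrDl.
Qed.

(** Turns [gauge_lt], which speaks of positive levels only, into equalities between gauges. *)
Let eq_ge0_lt (a b : R) : 0 <= a -> 0 <= b ->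
  (forall t, 0 < t -> a < t <-> b < t) -> a = b.
Proof.
move=> a0 b0 h; apply/eqP; rewrite eq_le !leNgt.
apply/andP; split; apply/negP => ab.
  by have /h[_ /(_ ab)] := le_lt_trans b0 ab; rewrite ltxx.
by have /h[/(_ ab)] := le_lt_trans a0 ab; rewrite ltxx.
Qed.

Lemma gauge_homothety x s : 0 < s -> gauge P c (c + s *: (x - c)) = s * gauge P c x.
Proof.
move=> s0; apply: eq_ge0_lt => [||t t0].
- exact: gauge_ge0.
- by rewrite mulr_ge0 ?gauge_ge0// ltW.
rewrite gauge_lt// mulrC -ltr_pdivlMr// gauge_lt ?divr_gt0//.
by rewrite [c + s *: _]addrC addrK scalerA invf_div mulrC.
Qed.

Lemma gauge_center : gauge P c c = 0.
Proof.
apply: eq_ge0_lt => // [|t t0]; first exact: gauge_ge0.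
by rewrite gauge_lt// subrr scaler0 addr0.
Qed.

(** For levels [a], [b] just above the two gauges, the rescaled points lie in [P]; mixing them with
    weights [t * a / d] and [(1 - t) * b / d] gives the combination rescaled by [d]. *)
Lemma gauge_convex x y t : 0 <= t -> t <= 1 ->
  gauge P c (t *: x + (1 - t) *: y) <= t * gauge P c x + (1 - t) * gauge P c y.
Proof.
move=> t0 t1; apply/ler_addgt0Pr => e e0.
set a := gauge P c x + e; set b := gauge P c y + e.
have a0 : 0 < a by rewrite ltr_wpDl// gauge_ge0.
have b0 : 0 < b by rewrite ltr_wpDl// gauge_ge0.
have Pa : P (c + a^-1 *: (x - c)) by apply/gauge_lt => //; rewrite ltrDl.
have Pb : P (c + b^-1 *: (y - c)) by apply/gauge_lt => //; rewrite ltrDl.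
have -> : t * gauge P c x + (1 - t) * gauge P c y + e = t * a + (1 - t) * b.
  by rewrite /a /b; ring.
set d := t * a + (1 - t) * b.
have d0 : 0 < d.
  rewrite /d; have [->|tn0] := eqVneq t 0; first by rewrite mul0r add0r subr0 mul1r.
  by rewrite ltr_pwDl ?mulr_ge0 ?subr_ge0 ?(ltW b0)// mulr_gt0// lt_neqAle eq_sym tn0.
apply: ltW; apply/gauge_lt => //.
have l0 : 0 <= t * a / d by rewrite divr_ge0 ?mulr_ge0// ltW.
have l1 : t * a / d <= 1.
  by rewrite ler_pdivrMr// mul1r lerDl mulr_ge0 ?subr_ge0// ltW.
suff <- : (t * a / d) *: (c + a^-1 *: (x - c)) +
    (1 - t * a / d) *: (c + b^-1 *: (y - c)) =
    c + d^-1 *: (t *: x + (1 - t) *: y - c) by exact: convex_set_conv.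
rewrite !scalerDr !scalerA addrACA -scalerDl (addrC _ (1 - _)) subrK scale1r.
have -> : (1 - t * a / d) * b^-1 = d^-1 * (1 - t).
  by rewrite /d; field; rewrite !gt_eqF.
have -> : t * a / d * a^-1 = d^-1 * t by field; rewrite !gt_eqF.
rewrite -!scalerA -!scalerDr [t *: (x - c)]scalerBr.
by rewrite [(1 - t) *: (y - c)]scalerBr addrACA -opprD -scalerDl addrCA subrr
  addr0 scale1r.
Qed.

End gauge.

(** * Volume of [P] and integrals of the truncated cones *)

Section gauge_integral.
Context {R : realType} {n : nat} {P : set 'rV[R]_n} {c : 'rV[R]_n}.
Hypotheses (oP : open P) (bP : bounded_set P).
Hypothesis cP : convex_set (P : set (convex_lmodType 'rV[R]_n)).
Hypothesis Pc : P c.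

Let mu := lebn R n.
Let D : set (Rprod R n) := @prod_to_row R n @^-1` P.
Let mD : measurable D := measurable_preimage_open oP.
Let G (x : Rprod R n) : R := gauge P c (prod_to_row x).
Let M := fine (leb_rV P).

Let G_ge0 x : 0 <= G x. Proof. exact: gauge_ge0. Qed.

Lemma leb_rV_gt0 : (0 < leb_rV P)%E.
Proof.
move: oP; rewrite openE => /(_ c Pc) /nbhs_ballP[r /= r0 rP].
have [b bc] := prod_to_row_surj n c.
apply: (@lt_le_trans _ _ (mu (@prod_to_row R n @^-1` ball (prod_to_row b) r))).
  by rewrite lebn_preimage_ball// lte_fin exprn_gt0// mulrn_wgt0.
rewrite /leb_rV le_measure ?inE//; first exact: measurable_preimage_ball.
by rewrite bc => x /rP.
Qed.

Lemma leb_rV_lty : (leb_rV P < +oo)%E.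
Proof.
have [A [_ PA]] := bP.
(* Every number above [A] bounds the norm on [P], in particular [|A| + 1]; one more unit makes the
   inclusion in the open ball strict. *)
have A0 : 0 < `|A| + 2 by rewrite ltr_wpDl.
have [b b0] := prod_to_row_surj n (0 : 'rV[R]_n).
apply: (@le_lt_trans _ _
  (mu (@prod_to_row R n @^-1` ball (prod_to_row b) (`|A| + 2)))).
  rewrite /leb_rV le_measure ?inE//; first exact: measurable_preimage_ball.
  move=> x Px; rewrite /= b0 -ball_normE /ball_ /= sub0r normrN.
  apply: (@le_lt_trans _ _ (`|A| + 1)); last by rewrite ltrD2l ltr1n.
  by apply: (PA (`|A| + 1)) => //; rewrite (le_lt_trans (ler_norm _))// ltrDl.
by rewrite lebn_preimage_ball// ltry.
Qed.

Let ME : mu D = M%:E.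
Proof. by rewrite fineK// ge0_fin_numE ?leb_rV_lty// ltW// leb_rV_gt0. Qed.

(** The translation [c - t^-1 *: c] makes [affmap] the homothety of ratio [t^-1] centred at [c]. *)
Let sublevel t : 0 < t ->
  exists2 b : Rprod R n, [set x | G x < t] = affmap t^-1 n b @^-1` D &
    forall x, G (affmap t^-1 n b x) = t^-1 * G x.
Proof.
move=> t0; have [b bE] := prod_to_row_surj n (c - t^-1 *: c).
have affE x : prod_to_row (affmap t^-1 n b x) = c + t^-1 *: (prod_to_row x - c).
  by rewrite prod_to_row_affmap bE scalerBr addrCA.
exists b => [|x]; last by rewrite /G affE gauge_homothety// invr_gt0.
apply/seteqP; split=> x; rewrite /D /= affE.
  by move/(gauge_lt oP cP Pc); exact.
by move=> ?; apply/(gauge_lt oP cP Pc).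
Qed.

Let measurable_sublevel t : measurable [set x | G x < t].
Proof.
have [t0|t0] := ltP 0 t.
  have [b -> _] := sublevel _ t0.
  by rewrite -[X in measurable X]setTI; exact: measurable_affmap.
rewrite (_ : [set _ | _] = set0); first exact: measurable0.
rewrite -subset0 => x /= /lt_le_trans => /(_ _ t0).
by rewrite ltNge gauge_ge0.
Qed.

Let mG : measurable_fun setT G.
Proof.
apply: (measurability _ (RGenInftyO.measurableE R)) => // _ [_ [x ->] <-].
by rewrite setTI; exact: measurable_sublevel.
Qed.

Let DE : D = [set x | G x < 1].
Proof.
apply/seteqP; split=> x /=.
  by move=> Px; apply/(gauge_lt oP cP Pc) => //; rewrite invr1 scale1r addrC subrK.
by move/(gauge_lt oP cP Pc); rewrite invr1 scale1r addrC subrK; exact.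
Qed.

Let cone t (x : Rprod R n) : R := Num.max 0 (t - G x).

Let cone_ge0 t x : 0 <= cone t x. Proof. by rewrite le_max lexx. Qed.

Let mcone t : measurable_fun setT (cone t).
Proof.
apply: measurable_maxr; first exact: measurable_cst.
by apply: measurable_funB; [exact: measurable_cst|exact: mG].
Qed.

Let bounded_integrable (f : Rprod R n -> R) (B : R) : measurable_fun setT f ->
  (forall x, `|f x| <= B) -> mu.-integrable D (EFin \o f).
Proof.
move=> mf fB; apply: measurable_bounded_integrable => //.
- by rewrite [X in (X < _)%E]ME ltry.
- exact: measurable_funTS.
- exists B; split=> [|A BA x _]; first exact: num_real.
  by rewrite /= (le_trans (fB x))// ltW.
Qed.

Let cone_integrable t : mu.-integrable D (EFin \o cone t).
Proof.
apply: (@bounded_integrable _ `|t|) => // x.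
rewrite ger0_norm// ge_max normr_ge0/= lerBlDr.
by rewrite (le_trans (ler_norm t))// lerDl gauge_ge0.
Qed.

Let K := \int[mu]_(x in D) cone 1 x.

(** Such a cone vanishes off [D]; on the whole space the change of variables needs no tracking of
    domains. *)
Let coneT t : t <= 1 -> (\int[mu]_(x in D) (cone t x)%:E = \int[mu]_x (cone t x)%:E)%E.
Proof.
move=> t1; rewrite integral_mkcond; apply: eq_integral => x _.
rewrite patchE; case: ifPn => //; rewrite notin_setE DE => /negP; rewrite -leNgt => Gx.
by rewrite /cone max_l// subr_le0 (le_trans t1).
Qed.

(** [cone t] is [t] times [cone 1] composed with the homothety of ratio [t^-1]: the height
    contributes one factor [t], the change of variables the other [n]. *)
Let cone_integral t : 0 < t -> t <= 1 ->
  \int[mu]_(x in D) cone t x = t ^+ n.+1 * K.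
Proof.
move=> t0 t1; rewrite /K /Rintegral !coneT//.
have [b _ bE] := sublevel _ t0.
transitivity (fine (\int[mu]_x (t%:E * (cone 1 (affmap t^-1 n b x))%:E))).
  congr fine; apply: eq_integral => x _.
  by rewrite -EFinM /cone bE maxr_pMr ?ltW// mulr0 mulrBr mulr1 mulVKf ?gt_eqF.
rewrite ge0_integralZl//; last 3 first.
- apply/measurable_EFinP; apply: measurableT_comp => //.
  exact: measurable_affmap.
- by move=> x _; rewrite lee_fin.
- by rewrite lee_fin ltW.
rewrite (ge0_integral_affmap _ _ b (fun x => (cone 1 x)%:E)) ?invr_gt0//; last 2 first.
- exact/measurable_EFinP.
- by move=> x; rewrite lee_fin.
rewrite exprVn invrK -coneT//.
have K_fin : (\int[mu]_(x in D) (cone 1 x)%:E)%E \is a fin_num.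
  exact: integrable_fin_num (cone_integrable 1).
by rewrite -(fineK K_fin) -!EFinM /= exprS mulrA.
Qed.

(* Both bounds on [K] below are [1 - s] times a bound on
   [K * \sum_(i < n.+1) s ^+ i], which is what survives as [s] tends to 1. *)
Let cone_upper s : 0 < s -> s < 1 -> K <= s ^+ n.+1 * K + (1 - s) * M.
Proof.
move=> s0 s1.
have i1 : mu.-integrable D (EFin \o cst (1 - s)).
  exact: (@bounded_integrable _ `|1 - s|).
have -> : (1 - s) * M = \int[mu]_(x in D) (1 - s) by rewrite Rintegral_cst.
rewrite -(cone_integral _ s0 (ltW s1)) -RintegralD//.
rewrite /K; apply: le_Rintegral => //.
  exact: (integrableD mD (cone_integrable s) i1).
(* Pointwise, raising the level from [s] to 1 raises the cone by at most [1 - s]. *)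
move=> x _; rewrite /cone; have G0 := G_ge0 x.
case: (leP 0 (1 - G x)) => [?|?]; case: (leP 0 (s - G x)) => [?|?]; lra.
Qed.

Let cone_lower s : 0 < s -> s < 1 ->
  s ^+ n.+1 * K + (1 - s) * (s ^+ n * M) <= K.
Proof.
move=> s0 s1; pose I : Rprod R n -> R := \1_[set x | G x < s].
have mI : measurable_fun setT I.
  exact: measurable_indic (measurable_sublevel s).
have iI : mu.-integrable D (EFin \o I).
  apply: (@bounded_integrable _ 1) => // x.
  by rewrite ger0_norm /I indicE; case: (_ \in _).
have IE : \int[mu]_(x in D) I x = s ^+ n * M.
  rewrite /Rintegral integral_indic// setIidl; last first.
    by rewrite DE => x /= /lt_trans; exact.
  have [b -> _] := sublevel _ s0.
  have si0 : 0 < s^-1 by rewrite invr_gt0.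
  have muE : mu (affmap s^-1 n b @^-1` D) = (s ^+ n * M)%:E.
    by rewrite EFinM -ME -[s ^+ n]invrK -exprVn; exact: lebn_affmap.
  exact: (congr1 fine muE).
rewrite -(cone_integral _ s0 (ltW s1)) -IE -RintegralZl// -RintegralD//; last first.
  exact: (integrableZl mD (1 - s) iI).
rewrite /K; apply: le_Rintegral => //.
  exact: (integrableD mD (cone_integrable s) (integrableZl mD (1 - s) iI)).
(* The rise is exactly [1 - s] where [G x < s], and nonnegative elsewhere. *)
move=> x _; rewrite /cone /I indicE; have G0 := G_ge0 x.
have [Gs|Gs] := ltP (G x) s.
  rewrite mem_set// mulr1.
  by case: (leP 0 (1 - G x)) => ?; case: (leP 0 (s - G x)) => ?; lra.
rewrite memNset /= ?mulr0; last by apply/negP; rewrite -leNgt.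
by case: (leP 0 (1 - G x)) => ?; case: (leP 0 (s - G x)) => ?; lra.
Qed.

(** The passage to the limit as [s] tends to 1, done by taking [s = 1 - k] with [k] small and using
    Bernoulli's inequality. *)
Let le_of_scaled (a b : R) : 0 <= a ->
  (forall s, 0 < s -> s < 1 -> a * s ^+ n <= b) -> a <= b.
Proof.
move=> a0 h; apply/ler_addgt0Pr => e e0.
have [k /andP[k0 k1] ke] : exists2 k : R, 0 < k < 1 & a * (n%:R * k) <= e.
  have an0 : 0 <= a * n%:R by rewrite mulr_ge0.
  (* The denominator exceeds both [e], giving [k < 1], and [a * n%:R], giving the bound by [e]. *)
  exists (e / (a * n%:R + e + 1)).
    by rewrite divr_gt0 ?ltr_pdivrMr ?mul1r//; lra.
  rewrite mulrA mulrCA ler_piMr// ?(ltW e0)// ler_pdivrMr ?mul1r; lra.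
have := h (1 - k); rewrite subr_gt0 ltrBlDr ltrDl => /(_ k1 k0).
apply: (fun H1 H2 => le_trans H1 (lerD H2 ke)).
(* Bernoulli's inequality. *)
have kn : 1 - n%:R * k <= (1 - k) ^+ n.
  elim: (n) => [|m IH]; first by rewrite mul0r subr0 expr0.
  rewrite exprS; apply: (@le_trans _ _ ((1 - k) * (1 - m%:R * k))).
    have m0 : 0 <= m%:R :> R by [].
    by rewrite -natr1; nra.
  by rewrite ler_wpM2l// subr_ge0 ltW.
rewrite -mulrDr ler_peMr//; lra.
Qed.

Let K_ge0 : 0 <= K.
Proof. by apply: Rintegral_ge0. Qed.

(** After division by [1 - s], the two cone bounds involve a geometric sum whose [n.+1] terms lie
    between [s ^+ n] and 1; [le_of_scaled] then removes [s ^+ n] from each. *)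
Let K_value : K * n.+1%:R = M.
Proof.
have pow_sum (s : R) : s ^+ n.+1 = 1 - (1 - s) * \sum_(i < n.+1) s ^+ i.
  by rewrite -(opprB s) mulNr -subrX1; ring.
have M0 : 0 <= M by rewrite fine_ge0// ltW// leb_rV_gt0.
have K0 : 0 <= K * n.+1%:R by rewrite mulr_ge0// K_ge0.
apply: le_anti; apply/andP; split; apply: le_of_scaled => // s s0 s1.
- have := cone_upper _ s0 s1; rewrite pow_sum => h.
  have {}h : K * \sum_(i < n.+1) s ^+ i <= M.
    rewrite -(@ler_pM2l _ (1 - s)) ?subr_gt0//; lra.
  apply: le_trans h; rewrite -mulrA ler_wpM2l ?K_ge0//.
  rewrite -[n.+1 in leLHS]card_ord -sumr_const mulr_suml ler_sum// => i _.
  by rewrite mul1r ler_wiXn2l// ?(ltW s0) ?(ltW s1)// -ltnS.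
- have := cone_lower _ s0 s1; rewrite pow_sum => h.
  have {}h : s ^+ n * M <= K * \sum_(i < n.+1) s ^+ i.
    rewrite -(@ler_pM2l _ (1 - s)) ?subr_gt0//; lra.
  rewrite mulrC (le_trans h)// ler_wpM2l ?K_ge0//.
  rewrite -[n.+1 in leRHS]card_ord -sumr_const ler_sum// => i _.
  by rewrite exprn_ile1// ltW.
Qed.

(** Shared by the integrals of [phi] and of its absolute value, which then differ only in their
    coefficients. *)
Let cone_comb (f : Rprod R n -> R) (a b d s : R) : 0 < s -> s <= 1 ->
  {in D, forall x, f x = a + (b * cone 1 x + d * cone s x)} ->
  mu.-integrable D (EFin \o f) /\
  (\int[mu]_(x in D) (f x)%:E)%E = (a * M + (b + d * s ^+ n.+1) * K)%:E.
Proof.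
move=> s0 s1 fE.
have ia : mu.-integrable D (EFin \o cst a).
  exact: (@bounded_integrable _ `|a|).
have ib := integrableZl mD b (cone_integrable 1).
have id := integrableZl mD d (cone_integrable s).
have ibd := integrableD mD ib id.
have fi : mu.-integrable D (EFin \o f).
  apply: eq_integrable (integrableD mD ia ibd) => //= x xD.
  by rewrite fE.
split=> //; rewrite -[LHS]fineK; last exact: integrable_fin_num.
rewrite -[fine _]/(\int[mu]_(x in D) f x)%R (eq_Rintegral _ fE).
rewrite RintegralD// RintegralD// !RintegralZl// (cone_integral _ s0 s1) Rintegral_cst//.
by congr EFin; rewrite /K /M; ring.
Qed.

(** * Integrals of the extremal function and of its absolute value *)

Section extremal.
Hypothesis n_gt0 : (0 < n)%N.

Let phi x := n.+1%:R / n%:R * gauge P c x - 1.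
Let N : R := n%:R.
Let N0 : 0 < N. Proof. by rewrite ltr0n. Qed.
Let N1 : n.+1%:R = N + 1. Proof. by rewrite natr1. Qed.
(** The gauge level at which [phi] changes sign. *)
Let s := N / (N + 1).
Let s_gt0 : 0 < s. Proof. by rewrite divr_gt0// addr_gt0. Qed.
Let s_le1 : s <= 1. Proof. by rewrite ler_pdivrMr ?mul1r ?addr_gt0// lerDl. Qed.
Let KE : K = M / (N + 1).
Proof. by rewrite -K_value N1 mulfK// gt_eqF// addr_gt0. Qed.

Let coneD x : x \in D -> cone 1 x = 1 - G x.
Proof. by rewrite DE inE /cone /= => Gx; rewrite max_r// subr_ge0 ltW. Qed.

(** On [D], [phi] is [N^-1 - (N + 1) / N * cone 1], and [K = M / (N + 1)] makes the two
    contributions cancel. *)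
Lemma gauge_extremal_integral : integrable_rV P phi /\ int_rV P phi = 0%E.
Proof.
have [] := @cone_comb (phi \o @prod_to_row R n) N^-1 (- ((N + 1) / N)) 0 s s_gt0 s_le1.
  move=> x /coneD ->; rewrite /= /phi N1 -/N -/(G x); field.
  by rewrite gt_eqF.
move=> iphi phiE; split=> //; rewrite /int_rV phiE KE; congr EFin; field.
by rewrite !gt_eqF// addr_gt0.
Qed.

(** The absolute value is [phi] plus twice its negative part [(N + 1) / N * cone s]. As [phi]
    integrates to zero, what remains is [2 * (N + 1) / N * s ^+ n.+1 * K], that is
    [2 * s ^+ n * K]. *)
Lemma gauge_extremal_abs_integral :
  int_rV P (fun x => `|phi x|) =
  (2 / n.+1%:R * (n%:R / n.+1%:R) ^+ n * M)%:E.
Proof.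
have [] := @cone_comb (fun x => `|phi (prod_to_row x)|) N^-1 (- ((N + 1) / N))
    (2 * (N + 1) / N) s s_gt0 s_le1.
  move=> x /coneD ->; rewrite /phi N1 -/N -/(G x).
  have -> : (N + 1) / N * G x - 1 = (N + 1) / N * (G x - s).
    by rewrite /s; field; rewrite !gt_eqF// addr_gt0.
  rewrite normrM gtr0_norm ?divr_gt0 ?addr_gt0//.
  have -> : `|G x - s| = G x - s + 2 * cone s x.
    rewrite /cone; have [sG|sG] := leP s (G x).
      by rewrite ger0_norm ?subr_ge0// max_l ?subr_le0// mulr0 addr0.
    rewrite ltr0_norm ?subr_lt0// max_r ?subr_ge0 ?(ltW sG)//; ring.
  by rewrite /s; field; rewrite !gt_eqF// addr_gt0.
move=> _ phiE; rewrite /int_rV phiE KE N1 -/N -/s exprS; congr EFin.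
(* One factor [s] cancels [(N + 1) / N], leaving [s ^+ n] as an atom for [field]. *)
have -> : - ((N + 1) / N) + 2 * (N + 1) / N * (s * s ^+ n) =
  - ((N + 1) / N) + 2 * s ^+ n.
  by congr (_ + _); rewrite /s; field; rewrite !gt_eqF// addr_gt0.
by field; rewrite !gt_eqF// addr_gt0.
Qed.

End extremal.

End gauge_integral.

(** * Convexity, infimum and equality for the extremal function *)

Theorem theorem1p2 (R : realType) (n : nat) (P : set 'rV[R]_n) :
  (1 <= n)%N -> open P -> bounded_set P -> convex_set (P : set (convex_lmodType 'rV[R]_n)) ->
  P !=set0 ->
  exists phi : 'rV[R]_n -> R,
    [/\ convex_function (P : set (convex_lmodType 'rV[R]_n)) phi,
        integrable_rV P phi,
        int_rV P phi = 0%E,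
        inf (phi @` P) = -1 &
        ((- (2 / n.+1%:R)) * (n%:R / n.+1%:R) ^+ n * inf (phi @` P))%:E
          = (((fine (leb_rV P))^-1)%:E * int_rV P (fun x => `|phi x|%R))%E].
Proof.
move=> n0 oP bP cP [c Pc].
have r0 : 0 <= n.+1%:R / n%:R :> R by rewrite divr_ge0.
pose phi (x : 'rV[R]_n) : R := n.+1%:R / n%:R * gauge P c x - 1.
have infE : inf (phi @` P) = -1.
  have phic : phi c = -1 by rewrite /phi (gauge_center oP cP Pc) mulr0 sub0r.
  have lb : lbound (phi @` P) (-1).
    by move=> _ [x _ <-]; rewrite lerDr mulr_ge0// gauge_ge0.
  apply: le_anti; apply/andP; split.
    by apply: ge_inf; [exists (-1)|exists c].
  by apply: lb_le_inf => //; exists (-1); exists c.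
have [iphi phi0] := gauge_extremal_integral oP bP cP Pc n0.
exists phi; split=> //.
- move=> t x y _ _; rewrite convRE.
  have t0 : 0 <= t%:num by [].
  have t1 : t%:num <= 1 by [].
  have := gauge_convex oP cP Pc x y _ t0 t1.
  move=> /(ler_wpM2l r0); rewrite /phi mulrDr => h.
  apply: (le_trans (lerD h (lexx (- 1 : R)))).
  (* What is left is an equality, since the constant [-1] splits with weights [t] and [1 - t]. *)
  rewrite -[leRHS]/(t%:num * phi x + (1 - t%:num) * phi y) le_eqVlt /phi.
  by apply/orP; left; apply/eqP; ring.
- rewrite infE gauge_extremal_abs_integral// -EFinM; congr EFin.
  (* [fine] sends an infinite value to 0, so cancelling the volume takes finiteness as well as
     positivity. *)
  have M0 : fine (leb_rV P) != 0.
    by rewrite gt_eqF// fine_gt0// (leb_rV_gt0 oP Pc) (leb_rV_lty oP bP).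
  by rewrite mulrCA mulVf// mulr1 mulrN1 mulNr opprK.
Qed.
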